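(* For all non-negative integers $n,a,b$, $$g_{n+a+b,n+a}\,g_{n+a,n}\succeq g_{n+a+b,n},$$ where $g_{m,i}$ denotes the coefficient of $x^i$ in $\hat p_m(x)$.
   Context: Let $\alpha,\beta,\epsilon_1,\epsilon_2,q$ be indeterminates and $[i]_q=1+q+\cdots+q^{i-1}$ for $i\ge0$ ($[0]_q=0$). The transformed Al-Salam-Chihara polynomials $(\hat p_n(x))_{n\ge0}$ are defined by $\hat p_{-1}(x)=0$, $\hat p_0(x)=1$ and, for $n\ge0$, $\hat p_{n+1}(x)=(x+b_n)\hat p_n(x)-\lambda_n\hat p_{n-1}(x)$, where $b_n=(\alpha+\beta)q^n+(\epsilon_1+\epsilon_2)[n]_q$ and $\lambda_n=\epsilon_1\epsilon_2[n]_q[n-1]_q+(\alpha\epsilon_2+\beta\epsilon_1)q^{n-1}[n]_q+\alpha\beta(q^{2n-1}-q^{n-1})$ (for $n\ge1$; $\lambda_0$ plays no role). The coefficients $g_{m,i}$ are polynomials in $\alpha,\beta,\epsilon_1,\epsilon_2,q$ with integer coefficients. For polynomials $f_1,f_2$ in $\alpha,\beta,\epsilon_1,\epsilon_2,q$, write $f_1\succeq f_2$ if $f_1-f_2$ is a polynomial all of whose coefficients are nonnegative (the zero polynomial is allowed). *)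

(* Defs.v *)
From mathcomp Require Import all_boot all_order all_algebra.
From mathcomp Require Import mpoly.

Set Implicit Arguments.
Unset Strict Implicit.
Unset Printing Implicit Defensive.

Import Order.TTheory GRing.Theory Num.Theory.
Local Open Scope ring_scope.

Notation coefRing := {mpoly int[5]}.

Definition alpha : coefRing := 'X_(inord 0).
Definition beta : coefRing := 'X_(inord 1).
Definition eps1 : coefRing := 'X_(inord 2).
Definition eps2 : coefRing := 'X_(inord 3).
Definition q : coefRing := 'X_(inord 4).

Definition qint (n : nat) : coefRing := \sum_(i < n) q ^+ i.

Definition b_ (n : nat) : coefRing :=
  (alpha + beta) * q ^+ n + (eps1 + eps2) * qint n.

(* Only meaningful for [0 < n]: the truncated subtractions in the exponents and
   in [n.-1] make [lambda_ 0] a junk value, which [phat] multiplies by 0. *)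
Definition lambda_ (n : nat) : coefRing :=
  eps1 * eps2 * qint n * qint n.-1
  + (alpha * eps2 + beta * eps1) * q ^+ n.-1 * qint n
  + alpha * beta * (q ^+ (2 * n).-1 - q ^+ n.-1).

(* The inner [match] is the polynomial of index m - 1, which is 0 at index -1. *)
Fixpoint phat (n : nat) : {poly coefRing} :=
  match n with
  | 0 => 1
  | m.+1 =>
      ('X + (b_ m)%:P) * phat m
      - (lambda_ m)%:P * match m with 0 => 0 | k.+1 => phat k end
  end.

Definition g (m i : nat) : coefRing := (phat m)`_i.

Definition coef_ge (f1 f2 : coefRing) : Prop :=
  forall m : 'X_{1..5}, 0 <= (f1 - f2)@_m.

(* Main.v *)
(* Write f * g for the q-binomial convolution (sum over k of [n k] f_k g_(n-k)).
   With A_n = prod_(t < n) (alpha q^t + eps1 [t]), and B_n the same with beta and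
   eps2, the coefficient sequences factor as g_(., i) = A * (B * L_(., i)), where
   L is the coefficient array for alpha = beta = 0; in particular W := A * B is
   g_(., 0).  For L everything is visibly positive: the recurrence factors as
   p_(n+1) = eps1 [n] p_n + r_(n+1), r_(n+1) = x p_n + eps2 [n] r_n.

   Expand g_(m, n) = sum_j [m j] L_(j, n) W_(m-j).  For j >= k use the minor
   L_(j, n) <= L_(j, k) L_(k, n); for j < k use
   [m j] W_(m-j) <= [k j] W_(k-j) g_(m, k).  The sum of these bounds is
   g_(m, k) g_(k, n).

   The second bound reduces to W_m <= W_k g_(m, k).  By q-Vandermonde,
   W_(k+l) = sum_i [k i] A_i B_(k-i) H_i with H_i made of A and B shifted by i
   and k - i, and expanding these shifts (rising_add) shows H_i <= g_(k+l, k)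
   for every i. *)

Require Import Defs.
From mathcomp Require Import all_boot all_order all_algebra.
From mathcomp Require Import mpoly ring.

Set Implicit Arguments.
Unset Strict Implicit.
Unset Printing Implicit Defensive.

Import Order.TTheory GRing.Theory Num.Theory.
Local Open Scope ring_scope.

Notation shift f := (fun n => f n.+1).

(** * q-integers, q-binomial coefficients and q-binomial convolution *)

Section QBinomial.
Variables (R : comNzRingType) (q : R).
Implicit Types (f g h : nat -> R) (n k i j : nat).

Definition qnat n : R := \sum_(i < n) q ^+ i.

Lemma qnat0 : qnat 0 = 0.
Proof. exact: big_ord0. Qed.

Lemma qnatS n : qnat n.+1 = qnat n + q ^+ n.
Proof. exact: big_ord_recr. Qed.

Lemma qnatD m n : qnat (m + n) = qnat m + q ^+ m * qnat n.
Proof.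
elim: n => [|n IHn]; first by rewrite addn0 qnat0; ring.
by rewrite addnS !qnatS IHn exprD; ring.
Qed.

Lemma qnatSl n : qnat n.+1 = 1 + q * qnat n.
Proof. by rewrite -add1n qnatD qnatS qnat0 add0r. Qed.

Lemma expr_qnat n : q ^+ n = 1 + (q - 1) * qnat n.
Proof. by rewrite -subrX1; ring. Qed.

Fixpoint qbin n k : R :=
  match n, k with
  | _, 0 => 1
  | 0, _.+1 => 0
  | n.+1, k.+1 => qbin n k + q ^+ k.+1 * qbin n k.+1
  end.

Lemma qbin0 n : qbin n 0 = 1.
Proof. by case: n. Qed.

Lemma qbin_small n k : (n < k)%N -> qbin n k = 0.
Proof.
elim: n k => [|n IHn] [|k] //= ltnk.
by rewrite (IHn k) // (IHn k.+1) ?mulr0 ?addr0 // ltnW.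
Qed.

Lemma qbinnn n : qbin n n = 1.
Proof. by elim: n => //= n ->; rewrite qbin_small ?mulr0 ?addr0. Qed.

Lemma qbinSr n k : qbin n.+1 k.+1 = q ^+ (n - k) * qbin n k + qbin n k.+1.
Proof.
elim: n k => [|n IHn] [|k]; rewrite ?subn0 /=; try ring.
  move: (IHn 0); rewrite /= !qbin0 subn0 => E.
  by rewrite {1}E !exprS; ring.
move: (IHn k) (IHn k.+1) => /= E1 E2; rewrite {1}E1 {1}E2 subSS.
have [ltkn|lenk] := ltnP k n.
  by rewrite -(subnSK ltkn) !exprS; move: (q ^+ (n - _)) => x; ring.
by rewrite !(@qbin_small n _.+1) ?ltnS ?(leqW lenk) //; ring.
Qed.

(** With upper index [n.+1], both sides equal [qbin n k * qnat n.+1]; where the subtraction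
    truncates, both vanish. *)
Lemma qbin_absorb n k : qbin n k.+1 * qnat k.+1 = qbin n k * qnat (n - k).
Proof.
elim: n k => [|n IHn] k; first by rewrite /= qnat0; ring.
have [ltnk|lekn] := ltnP n k.
  have /eqP-> : (n.+1 - k == 0)%N by rewrite subn_eq0.
  by rewrite (@qbin_small n.+1) // qnat0; ring.
transitivity (qbin n k * qnat n.+1).
  have -> : qnat n.+1 = qnat k.+1 + q ^+ k.+1 * qnat (n - k).
    by rewrite -qnatD addSn subnKC.
  by rewrite [qbin _ _]/= mulrDl -mulrA IHn; ring.
case: k lekn => [|k] lekn; first by rewrite !qbin0 subn0.
have -> : qnat n.+1 = qnat k.+1 + q ^+ k.+1 * qnat (n - k).
  by rewrite -qnatD addSn subnKC // ltnW.
by rewrite subSS [qbin n.+1 _]/= mulrDr mulrDl -IHn; ring.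
Qed.

(** Product of the generating functions sum_n f_n z^n / [n]!, written without dividing by [n]!. In
    this dictionary [qtwist i] substitutes q^i z for z, [lower] multiplies by z, [delta k] is z^k /
    [k]!, and [shift] is the q-derivative. *)
Definition conv f g n := \sum_(k < n.+1) qbin n k * f k * g (n - k)%N.

Definition qtwist i f n := q ^+ (i * n) * f n.

Definition lower f n := qnat n * f n.-1.

Definition delta k n : R := (n == k)%:R.

Lemma eq_conv f f' g g' : f =1 f' -> g =1 g' -> conv f g =1 conv f' g'.
Proof. by move=> ef eg n; apply: eq_bigr => i _; rewrite ef eg. Qed.

Lemma convDl f f' g n :
  conv (fun i => f i + f' i) g n = conv f g n + conv f' g n.
Proof. by rewrite -big_split; apply: eq_bigr => i _ /=; ring. Qed.

Lemma convDr f g g' n :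
  conv f (fun i => g i + g' i) n = conv f g n + conv f g' n.
Proof. by rewrite -big_split; apply: eq_bigr => i _ /=; ring. Qed.

Lemma convZl c f g n : conv (fun i => c * f i) g n = c * conv f g n.
Proof. by rewrite mulr_sumr; apply: eq_bigr => i _ /=; ring. Qed.

Lemma convZr c f g n : conv f (fun i => c * g i) n = c * conv f g n.
Proof. by rewrite mulr_sumr; apply: eq_bigr => i _ /=; ring. Qed.

Lemma conv0 f g : conv f g 0 = f 0%N * g 0%N.
Proof. by rewrite /conv big_ord1 qbin0 mul1r. Qed.

(** The q-Leibniz rule: F G has q-derivative F' G + F(q z) G'. *)
Lemma convS f g n :
  conv f g n.+1 = conv (shift f) g n + conv (qtwist 1 f) (shift g) n.
Proof.
rewrite /conv big_ord_recl [in X in _ = _ + X]big_ord_recl /= !qbin0 !subn0.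
rewrite /qtwist muln0 expr0 !mul1r [RHS]addrCA; congr (_ + _).
under eq_bigr => i _ do rewrite /bump /= add1n add0n subSS !mulrDl.
rewrite big_split /=; congr (_ + _).
rewrite big_ord_recr /= qbin_small // mulr0 !mul0r addr0.
apply: eq_bigr => i _.
by rewrite /bump /= add1n (subnSK (ltn_ord i)) mul1n; ring.
Qed.

Lemma convC f g n : conv f g n = conv g f n.
Proof.
rewrite /conv (reindex_inj rev_ord_inj) /=.
(* Symmetry of [qbin] comes from comparing its two Pascal rules. *)
have qbinC m : forall k, (k <= m)%N -> qbin m (m - k) = qbin m k.
  elim: m => [|m IHm] [|k] lekm //; rewrite ?subn0 ?qbinnn ?qbin0 // subSS.
  move: lekm; rewrite ltnS leq_eqVlt => /predU1P[->|ltkm].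
    by rewrite subnn qbin0 qbinnn.
  rewrite -(subnSK ltkm) qbinSr (subnSK ltkm) (IHm _ (ltnW ltkm)) IHm //=.
  by rewrite subKn //; ring.
apply: eq_bigr => i _; have lein : (i <= n)%N by rewrite -ltnS.
by rewrite subSS qbinC // subKn //; ring.
Qed.

Lemma qtwist_conv i f g n :
  qtwist i (conv f g) n = conv (qtwist i f) (qtwist i g) n.
Proof.
rewrite /qtwist mulr_sumr; apply: eq_bigr => k _.
by rewrite -{1}(subnKC (ltn_ord k : k <= n)%N) mulnDr exprD; ring.
Qed.

Lemma qtwistS i f n : shift (qtwist i f) n = q ^+ i * qtwist i (shift f) n.
Proof. by rewrite /qtwist mulnS exprD mulrA. Qed.

Lemma qtwist_add i j f n : qtwist i (qtwist j f) n = qtwist (i + j) f n.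
Proof. by rewrite /qtwist mulnDl exprD mulrA. Qed.

(** Both triple products obey the same q-Leibniz recursion, so induction on [n] over all sequences
    suffices. *)
Lemma convA f g h n : conv f (conv g h) n = conv (conv f g) h n.
Proof.
elim: n f g h => [|n IHn] f g h; first by rewrite !conv0 mulrA.
rewrite !convS IHn.
rewrite [X in _ + X = _](eq_conv (frefl _) (convS g h)).
rewrite [X in _ = X + _](eq_conv (convS f g) (frefl _)).
rewrite [X in _ = _ + X](eq_conv (qtwist_conv 1 f g) (frefl _)).
by rewrite convDr convDl !IHn addrA.
Qed.

Lemma convCA f g h n : conv f (conv g h) n = conv g (conv f h) n.
Proof. by rewrite !convA; apply: eq_conv => // i; apply: convC. Qed.

Lemma convS_r f g n :
  conv f g n.+1 = conv (shift f) (qtwist 1 g) n + conv f (shift g) n.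
Proof. by rewrite convC convS addrC !(convC f) (convC (shift f)). Qed.

Lemma qnat_conv f g n :
  qnat n * conv f g n =
  conv (fun i => qnat i * f i) (qtwist 1 g) n
  + conv f (fun i => qnat i * g i) n.
Proof.
rewrite mulr_sumr -big_split; apply: eq_bigr => k _ /=.
rewrite -{1}(subnK (ltn_ord k : k <= n)%N) qnatD /qtwist mul1n; ring.
Qed.

Lemma conv_delta k f n : conv (delta k) f n = qbin n k * f (n - k)%N.
Proof.
have [ltnk|lekn] := ltnP n k.
  rewrite qbin_small // mul0r /conv big1 // => i _.
  by rewrite /delta ltn_eqF ?mulr0 ?mul0r // (leq_trans (ltn_ord i)).
rewrite /conv (bigD1 (Ordinal (lekn : (k < n.+1)%N))) //= big1 => [|i].
  by rewrite /delta eqxx mulr1 addr0.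
by rewrite -val_eqE /= /delta => /negPf->; rewrite mulr0 mul0r.
Qed.

Lemma lowerE f n : lower f n = conv (delta 1) f n.
Proof.
rewrite conv_delta subn1 /lower; congr (_ * _).
by elim: n => [|n IHn]; rewrite ?qnat0 // qnatSl IHn /= qbin0 expr1.
Qed.

Lemma conv_lower_r f g n : conv f (lower g) n = lower (conv f g) n.
Proof.
rewrite lowerE convCA; apply: eq_conv => // i; exact: lowerE.
Qed.

Lemma conv_lower_l f g n : conv (lower f) g n = lower (conv f g) n.
Proof.
by rewrite convC conv_lower_r /lower convC.
Qed.

(** q-Vandermonde for convolutions: the q-Leibniz rule iterated [k] times, its terms collected by
    the second Pascal rule [qbinSr]. *)
Lemma conv_add f g k l :
  conv f g (k + l) = \sum_(i < k.+1) qbin k i *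
    conv (qtwist (k - i) (fun n => f (i + n)%N)) (fun n => g (k - i + n)%N) l.
Proof.
elim: k l => [|k IHk] l.
  rewrite big_ord1 mul1r; apply: eq_conv => // n.
  by rewrite /qtwist mul0n mul1r.
pose T i := conv (qtwist (k.+1 - i) (fun n => f (i + n)%N))
  (fun n => g (k.+1 - i + n)%N) l.
rewrite addSnnS IHk.
transitivity (\sum_(i < k.+1) (q ^+ (k - i) * qbin k i * T i.+1)
              + \sum_(i < k.+1) qbin k i * T i).
  rewrite -big_split; apply: eq_bigr => i _ /=.
  have leik : (i <= k)%N by rewrite -ltnS.
  rewrite convS mulrDr /T subSS; congr (_ + _).
    rewrite (eq_conv (qtwistS _ _) (frefl _)) convZl.
    rewrite mulrA [q ^+ _ * _]mulrC; congr (_ * _); apply: eq_conv => // n.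
    by rewrite /qtwist addnS.
  congr (_ * _); apply: eq_conv => n; last by rewrite subSn ?addSnnS.
  by rewrite qtwist_add subSn.
rewrite [X in _ + X]big_ord_recl [RHS]big_ord_recl /= !qbin0 addrCA.
congr (_ + _).
under [RHS]eq_bigr => i _ do
  rewrite -[X in X * _]/(qbin k.+1 (bump 0 i)) /bump add1n qbinSr mulrDl.
rewrite big_split /=; congr (_ + _).
by rewrite [RHS]big_ord_recr /= qbin_small // mul0r addr0.
Qed.

Definition rfact (e : R) i n := \prod_(t < n) (e * qnat (i + t)).

Lemma rfactSr e i n : rfact e i n.+1 = rfact e i n * (e * qnat (i + n)).
Proof. exact: big_ord_recr. Qed.

(** Recursion in the start rather than the length: the last factor splits by [i + n] = [i] + q^i
    [n]. It is matched against [leS_lahS] later. *)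
Lemma rfactS e i n :
  rfact e i.+1 n = rfact e i n + q ^+ i * e * lower (rfact e i.+1) n.
Proof.
rewrite /lower; case: n => [|n]; first by rewrite /rfact !big_ord0 qnat0; ring.
have -> : rfact e i n.+1 = e * qnat i * rfact e i.+1 n.
  rewrite /rfact big_ord_recl addn0; congr (_ * _).
  by apply: eq_bigr => j _; rewrite /bump /= addSnnS.
by rewrite rfactSr addSnnS qnatD /=; ring.
Qed.

Lemma rfact0 e : rfact e 0 =1 delta 0.
Proof.
case=> [|n]; first exact: big_ord0.
by rewrite /rfact big_ord_recl qnat0 mulr0 mul0r.
Qed.

End QBinomial.

(** * Al-Salam-Chihara coefficient arrays and their recurrence *)

Section AlSalamChihara.
Variables (R : comNzRingType) (q : R).
Implicit Types (a b e : R) (p s : nat -> nat -> R).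

Definition rising a e n : R := \prod_(t < n) (a * q ^+ t + e * qnat q t).

Lemma rising0 a e : rising a e 0 = 1.
Proof. exact: big_ord0. Qed.

Lemma risingS a e n :
  rising a e n.+1 =
  a * qtwist q 1 (rising a e) n + e * (qnat q n * rising a e n).
Proof. by rewrite /rising big_ord_recr /= /qtwist mul1n; ring. Qed.

(** Both sides satisfy the same first-order recurrence in [j], because the new factor splits as q^i
    (a q^j + e [j]) + e [i]. *)
Lemma rising_add a e i j :
  rising a e (i + j) =
  rising a e i * conv q (qtwist q i (rising a e)) (rfact q e i) j.
Proof.
elim: j => [|j IHj].
  by rewrite addn0 conv0 /qtwist muln0 rising0 /rfact big_ord0 !mulr1.
pose f := qtwist q i (rising a e); pose g := rfact q e i.
have fE : (fun n => f n.+1) =1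
    (fun n => q ^+ i * (a * qtwist q 1 f n + e * (qnat q n * f n))).
  by move=> n; rewrite /f qtwistS /qtwist risingS /qtwist; ring.
have gE : (fun n => g n.+1) =1
    (fun n => e * (qnat q i * g n + q ^+ i * (qnat q n * g n))).
  by move=> n; rewrite /g rfactSr qnatD; ring.
rewrite addnS risingS /qtwist mul1n -/f -/g.
rewrite convS_r (eq_conv _ fE (frefl _)) (eq_conv _ (frefl _) gE).
rewrite convZl convZr convDl convDr !convZl !convZr.
have -> : conv q (fun n => qnat q n * f n) (qtwist q 1 g) j =
    qnat q j * conv q f g j - conv q f (fun n => qnat q n * g n) j.
  by rewrite qnat_conv addrK.
rewrite -qtwist_conv /qtwist mul1n exprD qnatD IHj -/f -/g; ring.
Qed.

Definition mulX (u : nat -> R) i := if i is j.+1 then u j else 0.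

(* [p n i] is the coefficient of degree [i] of the polynomial of index [n].  The
   coefficient of [p n.-1] carries the factor [qnat q n], so its junk value at
   [n = 0] is harmless. *)
Definition asc_rec a b e1 e2 p :=
  (forall i, p 0%N i = (i == 0%N)%:R) /\
  forall n i, p n.+1 i = mulX (p n) i
    + ((a + b) * q ^+ n + (e1 + e2) * qnat q n) * p n i
    - qnat q n * (e1 * e2 * qnat q n.-1
                  + (a * e2 + b * e1 + a * b * (q - 1)) * q ^+ n.-1) * p n.-1 i.

Lemma asc_rec_uniq a b e1 e2 p s :
  asc_rec a b e1 e2 p -> asc_rec a b e1 e2 s -> p =2 s.
Proof.
move=> [p0 pS] [s0 sS]; suff H n : p n =1 s n /\ p n.+1 =1 s n.+1.
  by move=> n; case: (H n).
have step m : p m =1 s m -> p m.-1 =1 s m.-1 -> p m.+1 =1 s m.+1.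
  by move=> E E' i; rewrite pS sS E E'; case: i => //= i; rewrite E.
elim: n => [|n [IHn IHn1]]; last by split=> //; apply: step.
have E : p 0%N =1 s 0%N by move=> i; rewrite p0 s0.
by split=> //; apply: step.
Qed.

Lemma asc_rec_sym a b e1 e2 p : asc_rec a b e1 e2 p -> asc_rec b a e2 e1 p.
Proof. by move=> [p0 pS]; split=> // n i; rewrite pS; ring. Qed.

(** Convolution with [rising a e1] switches on the parameter [a]. Both sides of the recurrence are
    expanded into convolutions of [A] and [f] and their multiples by q^m and [m]. *)
Lemma asc_rec_conv a b e1 e2 s : asc_rec 0 b e1 e2 s ->
  asc_rec a b e1 e2 (fun n i => conv q (rising a e1) (fun m => s m i) n).
Proof.
move=> [s0 sS]; split=> [i|n i]; first by rewrite conv0 rising0 mul1r.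
set A := rising a e1; pose f m := s m i; pose t m := mulX (s m) i.
pose Mf := qtwist q 1 f; pose Nf m := qnat q m * f m.
pose MA := qtwist q 1 A; pose NA m := qnat q m * A m.
have sE m : f m.+1 = t m + (b * Mf m + ((e1 + e2) * Nf m +
    (- (e1 * e2) * lower q Nf m + - (b * e1) * lower q Mf m))).
  by rewrite /lower /Nf /Mf /qtwist /t /f sS !mul1n; ring.
have AE : (fun m => A m.+1) =1 (fun m => a * MA m + e1 * NA m).
  by move=> m; exact: risingS.
(* The rising sequence satisfies [n] A_n = [n] (SA)_(n-1) with S the shift, and
   lowering commutes with convolution; this is what produces lambda_n. *)
have NAE : NA =1 lower q (fun m => a * MA m + e1 * NA m).
  by case=> [|m]; rewrite /NA /lower ?qnat0 ?mul0r //= -AE.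
have ctE : conv q A t n = mulX (fun i => conv q A (fun m => s m i) n) i.
  rewrite /t; case: (i) => //=; by rewrite /conv big1 // => k _; rewrite mulr0.
have shE : conv q A f n.+1 = conv q A t n + (b * conv q A Mf n
    + ((e1 + e2) * conv q A Nf n + (- (e1 * e2) * lower q (conv q A Nf) n
    + - (b * e1) * lower q (conv q A Mf) n)))
    + (a * conv q MA Mf n + e1 * conv q NA Mf n).
  rewrite convS_r addrC (eq_conv _ (frefl _) sE) (eq_conv _ AE (frefl _)).
  by rewrite convDl !convDr !convZl !convZr !conv_lower_r.
(* From q^k = 1 + (q - 1) [k] one gets A = MA - (q - 1) NA, which eliminates [conv q A Mf]. *)
have MfE m : conv q A Mf m = conv q MA Mf m - (q - 1) * conv q NA Mf m.
  rewrite -mulNr -convZl -convDl; apply: eq_conv => // k.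
  by rewrite /MA /NA /qtwist mul1n expr_qnat; ring.
have qtE m : q ^+ m * conv q A f m = conv q MA Mf m.
  by rewrite -qtwist_conv /qtwist mul1n.
have NE m : qnat q m * conv q A f m = conv q A Nf m + conv q NA Mf m.
  by rewrite qnat_conv addrC.
have lowE : conv q NA Mf n =
    a * lower q (conv q MA Mf) n + e1 * lower q (conv q NA Mf) n.
  by rewrite (eq_conv _ NAE (frefl _)) conv_lower_l /lower convDl !convZl; ring.
rewrite -/f shE -ctE; set x := conv q A t n.
have -> : qnat q n * (e1 * e2 * qnat q n.-1 +
     (a * e2 + b * e1 + a * b * (q - 1)) * q ^+ n.-1) * conv q A f n.-1
  = qnat q n * (e1 * e2 * (qnat q n.-1 * conv q A f n.-1) +
     (a * e2 + b * e1 + a * b * (q - 1)) * (q ^+ n.-1 * conv q A f n.-1)).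
  by ring.
have -> : ((a + b) * q ^+ n + (e1 + e2) * qnat q n) * conv q A f n
  = (a + b) * (q ^+ n * conv q A f n) + (e1 + e2) * (qnat q n * conv q A f n).
  by ring.
rewrite !NE !qtE MfE.
(* The goal is now linear in a few convolutions at [n] and [n.-1], and [lowE] is the one relation
   left between them. *)
rewrite /lower MfE; move: lowE; rewrite /lower => lowE; ring: lowE.
Qed.

End AlSalamChihara.

(** * The q-Lah array *)

Section Lah.
Variables (R : comNzRingType) (q : R).

(* The case alpha = beta = 0.  With r_n = p_n - e1 [n-1] p_(n-1), the three-term
   recurrence splits into two subtraction-free ones; the first component is p_n,
   the second r_n. *)
Fixpoint lah_pair (e1 e2 : R) n : (nat -> R) * (nat -> R) :=
  if n is m.+1 then
    let u := lah_pair e1 e2 m in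
    let r i := mulX u.1 i + e2 * qnat q m * u.2 i in
    (fun i => e1 * qnat q m * u.1 i + r i, r)
  else (delta R 0, delta R 0).

Definition lah (e1 e2 : R) n i := (lah_pair e1 e2 n).1 i.
Definition lahr (e1 e2 : R) n i := (lah_pair e1 e2 n).2 i.

Lemma lah0 e1 e2 i : lah e1 e2 0 i = (i == 0%N)%:R.
Proof. by []. Qed.

Lemma lahr0 e1 e2 i : lahr e1 e2 0 i = (i == 0%N)%:R.
Proof. by []. Qed.

Lemma lahrS e1 e2 n i :
  lahr e1 e2 n.+1 i = mulX (lah e1 e2 n) i + e2 * qnat q n * lahr e1 e2 n i.
Proof. by []. Qed.

Lemma lahS e1 e2 n i :
  lah e1 e2 n.+1 i = e1 * qnat q n * lah e1 e2 n i + lahr e1 e2 n.+1 i.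
Proof. by []. Qed.

Lemma lah_asc e1 e2 : asc_rec q 0 0 e1 e2 (lah e1 e2).
Proof.
split=> // n i; rewrite lahS lahrS; case: n => [|n].
  by rewrite qnat0; ring.
by rewrite /= (lahS _ _ n); ring.
Qed.

(** [lah_pair] treats its parameters asymmetrically, but the three-term recurrence determines the
    array and is symmetric in them. *)
Lemma lahC e1 e2 : lah e1 e2 =2 lah e2 e1.
Proof. exact: asc_rec_uniq (lah_asc e1 e2) (asc_rec_sym (lah_asc e2 e1)). Qed.

Lemma lah_small_pair e1 e2 n i :
  (n < i)%N -> lah e1 e2 n i = 0 /\ lahr e1 e2 n i = 0.
Proof.
elim: n i => [|n IHn] [|i] // ltni; have [E _] := IHn i ltni.
have [E1 E2] := IHn i.+1 (ltnW ltni).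
have E3 : lahr e1 e2 n.+1 i.+1 = 0 by rewrite lahrS /= E E2 mulr0 addr0.
by rewrite lahS E1 E3 mulr0 addr0.
Qed.

Lemma lahnn_pair e1 e2 n : lah e1 e2 n n = 1 /\ lahr e1 e2 n n = 1.
Proof.
elim: n => // n [IHn _]; have [E1 E2] := lah_small_pair e1 e2 (ltnSn n).
have E : lahr e1 e2 n.+1 n.+1 = 1 by rewrite lahrS /= IHn E2 mulr0 addr0.
by rewrite lahS E E1 mulr0 add0r.
Qed.

Lemma lahnn e1 e2 n : lah e1 e2 n n = 1.
Proof. by have [] := lahnn_pair e1 e2 n. Qed.

Lemma lahrnn e1 e2 n : lahr e1 e2 n n = 1.
Proof. by have [] := lahnn_pair e1 e2 n. Qed.

End Lah.

(** * The order whose nonnegative elements form a semiring containing q *)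

Section CoefficientwiseOrder.
Variables (R : comNzRingType) (S : semiringClosed R) (q : R).
Hypothesis Sq : q \in S.
Implicit Types (x y z : R) (f g h : nat -> R).

Local Notation "x <=S y" := (y - x \in S) (at level 70).

Lemma leSS x : x <=S x.
Proof. by rewrite subrr rpred0. Qed.

Lemma leS_trans y x z : x <=S y -> y <=S z -> x <=S z.
Proof. by move=> lexy leyz; rewrite -(subrK y z) -addrA rpredD. Qed.

Lemma leSD x x' y y' : x <=S x' -> y <=S y' -> x + y <=S x' + y'.
Proof. by move=> lex ley; rewrite opprD addrACA rpredD. Qed.

Lemma leSM x x' y y' :
  x \in S -> y' \in S -> x <=S x' -> y <=S y' -> x * y <=S x' * y'.
Proof.
move=> Sx Sy' lex ley; have -> : x' * y' - x * y = (x' - x) * y' + x * (y' - y).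
  by ring.
by rewrite rpredD ?rpredM.
Qed.

Lemma leSMl z x y : z \in S -> x <=S y -> z * x <=S z * y.
Proof. by move=> Sz lexy; rewrite -mulrBr rpredM. Qed.

Lemma leSMr z x y : z \in S -> x <=S y -> x * z <=S y * z.
Proof. by move=> Sz lexy; rewrite -mulrBl rpredM. Qed.

Lemma leS_sum (I : Type) (r : seq I) (P : pred I) (F G : I -> R) :
  (forall i, P i -> F i <=S G i) ->
  \sum_(i <- r | P i) F i <=S \sum_(i <- r | P i) G i.
Proof. by move=> leFG; rewrite -sumrB rpred_sum. Qed.

Lemma leS_sum_nat m n (F G : nat -> R) :
  (forall i, (m <= i < n)%N -> F i <=S G i) ->
  \sum_(m <= i < n) F i <=S \sum_(m <= i < n) G i.
Proof.
by move=> leFG; rewrite big_nat [X in _ - X]big_nat; apply: leS_sum.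
Qed.

Lemma qnat_in n : qnat q n \in S.
Proof. by rewrite rpred_sum // => i _; rewrite rpredX. Qed.

Lemma qbin_in n k : qbin q n k \in S.
Proof.
elim: n k => [|n IHn] [|k] /=; rewrite ?rpred1 ?rpred0 //.
by rewrite rpredD ?rpredM ?rpredX.
Qed.

Lemma leS_qnatD m n : q ^+ m * qnat q n <=S qnat q (m + n).
Proof. by rewrite qnatD addrK qnat_in. Qed.

(** By absorption, the difference is exactly q^n times [qbin q (n + j).+1 j]. *)
Lemma leS_qbin_qnat n j :
  qbin q (n + j).+2 j.+1 * qnat q n <=S
  qbin q (n + j).+1 j.+1 * qnat q (n + j).+1.
Proof.
set N := (n + j).+1; have NjE : (N - j)%N = n.+1 by rewrite /N -addSn addnK.
have absorb := qbin_absorb q N j; rewrite NjE (qnatSl q n) in absorb.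
rewrite qbinSr NjE exprS {2}/N -addnS qnatD.
have -> : qbin q N j.+1 * (qnat q n + q ^+ n * qnat q j.+1)
    - (q * q ^+ n * qbin q N j + qbin q N j.+1) * qnat q n
  = q ^+ n * (qbin q N j.+1 * qnat q j.+1)
    - q ^+ n * (q * qbin q N j * qnat q n) by ring.
rewrite absorb; set y := qbin q N j.
have -> : q ^+ n * (y * (1 + q * qnat q n)) - q ^+ n * (q * y * qnat q n)
  = q ^+ n * y by ring.
by rewrite rpredM ?rpredX ?qbin_in.
Qed.

Lemma conv_in f g n :
  (forall i, f i \in S) -> (forall i, g i \in S) -> conv q f g n \in S.
Proof.
by move=> Sf Sg; rewrite rpred_sum // => i _; rewrite !rpredM ?qbin_in.
Qed.

Lemma leS_conv f g h n : (forall i, f i \in S) ->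
  (forall i, g i <=S h i) -> conv q f g n <=S conv q f h n.
Proof.
by move=> Sf legh; apply: leS_sum => i _; rewrite leSMl ?rpredM ?qbin_in.
Qed.

Lemma qtwist_in i f n : (forall j, f j \in S) -> qtwist q i f n \in S.
Proof. by move=> Sf; rewrite rpredM ?rpredX. Qed.

(** Differentiate the product [k] times, always dropping the term that differentiates [f]. The two
    forms [convS] and [convS_r] of the Leibniz rule do or do not twist [f]; using the first one [i]
    times gives the bound. *)
Lemma leS_conv_shift f h i k l :
  (forall j, f j \in S) -> (forall j, h j \in S) -> (i <= k)%N ->
  conv q (qtwist q i f) (fun n => h (k + n)%N) l <=S conv q f h (k + l).
Proof.
elim: k i f h => [|k IHk] i f h Sf Sh leik.
  case: i leik => // _; rewrite (eq_conv _ (_ : _ =1 f) (frefl h)) ?leSS //.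
  by move=> n; rewrite /qtwist mul0n mul1r.
rewrite addSn; case: i leik => [|i] leik.
  rewrite convS_r; apply: leS_trans (IHk 0 f (shift h) Sf _ _) _ => //.
  by rewrite addrK conv_in // => n; exact: qtwist_in.
rewrite convS; have := IHk i (qtwist q 1 f) (shift h).
have twE : qtwist q i (qtwist q 1 f) =1 qtwist q i.+1 f.
  by move=> n; rewrite qtwist_add addn1.
rewrite (eq_conv _ twE (frefl _)).
move=> IH; apply: leS_trans (IH _ _ _) _ => //.
  by move=> n; exact: qtwist_in.
by rewrite addrK conv_in.
Qed.

(** * Inequalities for the q-Lah array *)

Section LahOrder.
Variables e1 e2 : R.
Hypotheses (Se1 : e1 \in S) (Se2 : e2 \in S).

(** The parameters are free because [leS_rfact_lah] uses the array with [e1] and [e2] exchanged. *)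
Lemma lah_in_pair a b n i :
  a \in S -> b \in S -> lah q a b n i \in S /\ lahr q a b n i \in S.
Proof.
move=> Sa Sb; elim: n i => [|n IHn] i.
  by rewrite lah0 lahr0 rpred_nat.
have [E E'] := IHn i; suff Sr : lahr q a b n.+1 i \in S.
  by rewrite lahS rpredD ?rpredM ?qnat_in.
rewrite lahrS rpredD ?rpredM ?qnat_in //.
by case: i {E E'} => [|i] /=; [exact: rpred0 | have [] := IHn i].
Qed.

Lemma lah_in a b n i : a \in S -> b \in S -> lah q a b n i \in S.
Proof. by move=> Sa Sb; have [] := lah_in_pair n i Sa Sb. Qed.

Lemma lahr_in a b n i : a \in S -> b \in S -> lahr q a b n i \in S.
Proof. by move=> Sa Sb; have [] := lah_in_pair n i Sa Sb. Qed.

(** The difference is the term b [n] r_n of the split recurrence. *)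
Lemma leS_lahS a b n i : a \in S -> b \in S ->
  lah q a b n i + a * qnat q n * lah q a b n i.+1 <=S lah q a b n.+1 i.+1.
Proof.
move=> Sa Sb; have -> : lah q a b n.+1 i.+1 -
      (lah q a b n i + a * qnat q n * lah q a b n i.+1) =
    b * qnat q n * lahr q a b n i.+1.
  by rewrite lahS lahrS /=; ring.
by rewrite !rpredM ?qnat_in ?lahr_in.
Qed.

Lemma leS_lahSS n i : lah q e1 e2 n i <=S lah q e1 e2 n.+1 i.+1.
Proof.
apply: leS_trans (leS_lahS n i Se1 Se2).
by rewrite addrAC subrr add0r !rpredM ?qnat_in ?lah_in.
Qed.

(** Proved together with a bound for [lahr]: induction on [k], then on the distance from [k.+1] to
    [m]. The row recurrence acts only on the first factor, so both bounds share the second factor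
    [lah q e1 e2 k n]. *)
Lemma leS_lah_minor n k m : (n <= k <= m)%N ->
  lah q e1 e2 m n <=S lah q e1 e2 m k * lah q e1 e2 k n.
Proof.
suff: (n <= k <= m)%N ->
    lah q e1 e2 m n <=S lah q e1 e2 m k * lah q e1 e2 k n /\
    lahr q e1 e2 m n <=S lahr q e1 e2 m k * lah q e1 e2 k n.
  by move=> H /H[].
elim: k n m => [|k IHk] n m /andP[lenk lekm].
  by move: lenk; rewrite leqn0 => /eqP->; rewrite lahnn !mulr1 !leSS.
move: lenk; rewrite leq_eqVlt => /predU1P[->|ltnk].
  by rewrite lahnn !mulr1 !leSS.
rewrite -(subnKC lekm); elim: (m - k.+1)%N => [|d [IHd IHrd]].
  rewrite addn0 lahnn lahrnn !mul1r leSS; split=> //.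
  by rewrite lahS addrK !rpredM ?qnat_in ?lah_in.
rewrite addnS; set N := (k.+1 + d)%N in IHd IHrd *.
have lekN : (k <= N)%N by rewrite /N addSnnS leq_addr.
have r_le : lahr q e1 e2 N.+1 n <=S lahr q e1 e2 N.+1 k.+1 * lah q e1 e2 k.+1 n.
  rewrite !lahrS mulrDl; apply: leSD; last first.
    by rewrite -mulrA; apply: leSMl => //; rewrite rpredM ?qnat_in.
  case: n ltnk {IHd IHrd} => [|n] ltnk /=.
    by rewrite subr0 rpredM ?lah_in.
  (* Only the [mulX] term changes columns: the minor at [k] is used, then its second factor is moved
     one step down the diagonal by [leS_lahSS]. *)
  have [|le_n _] := IHk n N; first by rewrite lekN andbT -ltnS ltnW.
  by apply: leS_trans le_n _; apply: leSMl; rewrite ?lah_in ?leS_lahSS.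
split=> //; rewrite !(lahS _ _ _ N) mulrDl; apply: leSD => //.
by rewrite -mulrA; apply: leSMl => //; rewrite rpredM ?qnat_in.
Qed.

(** Induction on [j], then on [n], jointly for [lah] and [lahr]. Terms of the recurrence carrying a
    q-integer are compared by [leS_qbin_qnat]. *)
Lemma leS_qbin_lah n k j :
  qbin q (n + j) j * lah q e1 e2 n k <=S
  qbin q (k + j) j * lah q e1 e2 (n + j) (k + j).
Proof.
suff: qbin q (n + j) j * lah q e1 e2 n k <=S
    qbin q (k + j) j * lah q e1 e2 (n + j) (k + j) /\
  qbin q (n + j) j * lahr q e1 e2 n k <=S
    qbin q (k + j) j * lahr q e1 e2 (n + j) (k + j) by case.
elim: j n k => [|j IHj] n k; first by rewrite !addn0 !qbin0 !leSS.
elim: n k => [|n IHn] k.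
  case: k => [|k]; first by rewrite !add0n !lahnn !lahrnn !leSS.
  by rewrite lah0 lahr0 !mulr0 !subr0 !rpredM ?qbin_in ?lah_in ?lahr_in.
have leSMD (c c' x x' y y' : R) : c * x <=S c' * x' -> c * y <=S c' * y' ->
    c * (x + y) <=S c' * (x' + y') by rewrite !mulrDr; exact: leSD.
have step (e x y : R) : e \in S -> x \in S ->
    qbin q (n + j.+1) j.+1 * x <=S qbin q (k + j.+1) j.+1 * y ->
  qbin q (n + j).+2 j.+1 * (e * qnat q n * x) <=S
  qbin q (k + j.+1) j.+1 * (e * qnat q (n + j).+1 * y).
  move=> Se Sx lexy; rewrite -![e * _ * _]mulrA 2!(mulrCA _ e).
  apply: leSMl => //.
  apply: (@leS_trans (qbin q (n + j).+1 j.+1 * qnat q (n + j).+1 * x)).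
    by rewrite [X in _ - X]mulrA; apply: leSMr => //; apply: leS_qbin_qnat.
  rewrite mulrCA (mulrC (qbin q (n + j).+1 _)) -mulrA.
  by apply: leSMl; rewrite ?qnat_in // -addnS.
have [le_p le_r] := IHn k; rewrite addSn (addnS n).
have r_le : qbin q (n + j).+2 j.+1 * lahr q e1 e2 n.+1 k <=S
    qbin q (k + j.+1) j.+1 * lahr q e1 e2 (n + j).+2 (k + j.+1).
  rewrite (lahrS _ _ _ n) (lahrS _ _ _ (n + j).+1); apply: leSMD; last first.
    by apply: step; rewrite ?lahr_in // -addnS.
  case: k {step le_p le_r} => [|k].
    by rewrite [mulX _ 0]/= mulr0 subr0 rpredM ?qbin_in ?lah_in.
  (* Pascal on both sides: the first parts compare by induction on [j], the second by induction on
     [n]. *)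
  have -> : qbin q (n + j).+2 j.+1 =
      qbin q (n.+1 + j) j + q ^+ j.+1 * qbin q (n + j.+1) j.+1 by rewrite addnS.
  have -> : qbin q (k.+1 + j.+1) j.+1 =
      qbin q (k.+1 + j) j + q ^+ j.+1 * qbin q (k + j.+1) j.+1.
    by rewrite [in RHS]addSnnS.
  rewrite -[mulX _ (k.+1 + _)]/(lah q e1 e2 (n + j).+1 (k + j.+1)).
  rewrite -[mulX _ k.+1]/(lah q e1 e2 n k) 2!mulrDl; apply: leSD.
    apply: (@leS_trans (qbin q (n.+1 + j) j * lah q e1 e2 n.+1 k.+1)).
      by apply: leSMl; rewrite ?qbin_in ?leS_lahSS.
    by have [+ _] := IHj n.+1 k.+1; rewrite (addSnnS k) (addSn n).
  rewrite -2!mulrA; apply: leSMl; rewrite ?rpredX //.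
  by have [+ _] := IHn k; rewrite (addnS n).
split=> //; rewrite (lahS _ _ _ n) (lahS _ _ _ (n + j).+1).
by apply: leSMD => //; apply: step; rewrite ?lah_in // -addnS.
Qed.

(** The recursion [rfactS] in the start index is dominated by [leS_lahS], since q^k [m + 1] is at
    most [k + m + 1]; [step] combines the two. *)
Lemma leS_rfact_lah i1 i2 l :
  conv q (qtwist q i2 (rfact q e1 i1)) (rfact q e2 i2) l <=S
  lah q e1 e2 (i1 + i2 + l) (i1 + i2).
Proof.
have step a b k m x y : a \in S -> b \in S ->
    x <=S lah q a b (k + m.+1) k -> y <=S lah q a b (k.+1 + m) k.+1 ->
  x + a * q ^+ k * (qnat q m.+1 * y) <=S lah q a b (k.+1 + m.+1) k.+1.
  move=> Sa Sb lex ley; rewrite addSn.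
  apply: leS_trans (leS_lahS _ _ Sa Sb); apply: leSD => //.
  rewrite -!mulrA; apply: leSMl => //; rewrite mulrA.
  apply: leSM; rewrite ?lah_in ?rpredM ?rpredX ?qnat_in ?leS_qnatD //.
  by rewrite addnS -addSn.
have in_rfact e i n : e \in S -> rfact q e i n \in S.
  by move=> Se; rewrite rpred_prod // => t _; rewrite rpredM ?qnat_in.
have base k n : rfact q e2 k n <=S lah q e1 e2 (k + n) k.
  (* [step] multiplies by the first parameter of the array, which here has to be [e2]. *)
  rewrite lahC; elim: n k => [|n IHn] k.
    by rewrite addn0 lahnn /rfact big_ord0 leSS.
  elim: k => [|k IHk]; first by rewrite rfact0 subr0 lah_in.
  rewrite rfactS /lower (mulrC _ e2); apply: step => //.
elim: i1 l => [|i1 IHi] l.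
  rewrite (eq_conv _ (_ : _ =1 delta R 0) (frefl _)); last first.
    by case=> [|n]; rewrite /qtwist rfact0 /delta ?muln0 ?mulr1 ?mulr0.
  by rewrite conv_delta qbin0 mul1r subn0.
have hE : qtwist q i2 (rfact q e1 i1.+1) =1 (fun n =>
    qtwist q i2 (rfact q e1 i1) n +
    e1 * q ^+ (i1 + i2) * lower q (qtwist q i2 (rfact q e1 i1.+1)) n).
  move=> n; rewrite /qtwist rfactS /lower; case: n => [|n].
    by rewrite qnat0; ring.
  by rewrite mulnS exprD exprD /=; ring.
elim: l => [|l IHl].
  by rewrite conv0 /qtwist muln0 /rfact !big_ord0 addn0 lahnn !mulr1 leSS.
rewrite (eq_conv _ hE (frefl _)) convDl convZl conv_lower_l /lower addSn.
by apply: step => //; rewrite -addSn.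
Qed.

End LahOrder.

(** * The minor inequality for general parameters *)

Section Minor.
Variables a b e1 e2 : R.
Hypotheses (Sa : a \in S) (Sb : b \in S) (Se1 : e1 \in S) (Se2 : e2 \in S).

Let A := rising q a e1.
Let B := rising q b e2.
Let W := conv q A B.
(** The degree comes first, so that a column [L i] is a sequence to convolve; likewise for [P]. *)
Let L i n := lah q e1 e2 n i.
Let P i := conv q A (conv q B (L i)).

(** Starting from the q-Lah array, [b] is switched on between two swaps of the parameter pairs, then
    [a]. *)
Lemma asc_rec_rising : asc_rec q a b e1 e2 (fun n i => P i n).
Proof.
apply: (@asc_rec_conv _ q a b e1 e2 (fun n i => conv q B (L i) n)).
exact/asc_rec_sym/asc_rec_conv/asc_rec_sym/lah_asc.
Qed.

Lemma rising_in c e n : c \in S -> e \in S -> rising q c e n \in S.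
Proof.
move=> Sc Se; rewrite rpred_prod // => t _.
by rewrite rpredD ?rpredM ?rpredX ?qnat_in.
Qed.

Let A_in n : A n \in S. Proof. exact: rising_in. Qed.
Let B_in n : B n \in S. Proof. exact: rising_in. Qed.
Let L_in i n : L i n \in S. Proof. exact: lah_in. Qed.
Let W_in n : W n \in S. Proof. exact: conv_in. Qed.
Let P_in i n : P i n \in S. Proof. by do 2 apply: conv_in => // ?. Qed.

Let PE i n : P i n = conv q W (L i) n. Proof. exact: convA. Qed.

Lemma leS_constant_coef k l : W (k + l)%N <=S W k * P k (k + l)%N.
Proof.
rewrite /W conv_add [conv q A B k]/conv mulr_suml; apply: leS_sum => i _.
have leik : (i <= k)%N by rewrite -ltnS.
rewrite -!mulrA; apply: leSMl; rewrite ?qbin_in //.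
set j := (k - i)%N; have kE : (i + j)%N = k by rewrite subnKC.
pose X := conv q (qtwist q i A) (rfact q e1 i).
pose Y := conv q (qtwist q j B) (rfact q e2 j).
have AE : qtwist q j (fun n => A (i + n)%N) =1 (fun n => A i * qtwist q j X n).
  by move=> n; rewrite /qtwist /A rising_add /X; ring.
have BE : (fun n => B (j + n)%N) =1 (fun n => B j * Y n).
  by move=> n; rewrite /B rising_add.
rewrite (eq_conv _ AE BE) convZl convZr; do 2 apply: leSMl => //.
have XE : qtwist q j X =1 conv q (qtwist q k A) (qtwist q j (rfact q e1 i)).
  move=> n; rewrite qtwist_conv; apply: eq_conv => // m.
  by rewrite qtwist_add addnC kE.
rewrite (eq_conv _ XE (frefl _)) -convA.
rewrite (eq_conv _ (frefl _) (convCA q _ _ _)).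
(* The twists of [A] and [B] are by [k] and [k - i], at most [k]; [leS_conv_shift] absorbs each in
   turn, leaving the bound [leS_rfact_lah]. *)
apply: leS_trans (leS_conv_shift l A_in _ (leqnn k)); last first.
  by move=> n; apply: conv_in.
apply: leS_conv => n; first exact: qtwist_in.
apply: leS_trans (leS_conv_shift n B_in (L_in k) (leq_subr i k)).
apply: leS_conv => m; first exact: qtwist_in.
by have := leS_rfact_lah Se1 Se2 i j m; rewrite kE.
Qed.

Lemma leS_qbin_constant_coef j k m : (j <= k <= m)%N ->
  qbin q m j * W (m - j)%N <=S qbin q k j * W (k - j)%N * P k m.
Proof.
move=> /andP[lejk lekm].
apply: (@leS_trans (W (k - j)%N * (qbin q m j * P (k - j) (m - j)%N))).
  rewrite mulrCA; apply: leSMl; rewrite ?qbin_in //.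
  have -> : (m - j)%N = (k - j + (m - k))%N by rewrite addnC addnBA // subnK.
  exact: leS_constant_coef.
rewrite [qbin q k j * _]mulrC -mulrA; apply: leSMl => //.
(* Convolution with [delta q j] is what carries the q-binomial past [W], onto the column of [L],
   where [leS_qbin_lah] applies termwise. *)
rewrite -conv_delta (eq_conv _ (frefl _) (PE _)) convCA PE -convZr.
apply: leS_conv => // n; rewrite conv_delta.
have [ltnj|lejn] := ltnP n j.
  by rewrite (qbin_small _ ltnj) mul0r subr0 !rpredM ?qbin_in.
by have := leS_qbin_lah Se1 Se2 (n - j) (k - j) j; rewrite !subnK.
Qed.

Lemma leS_minor n k m : (n <= k <= m)%N -> P n m <=S P k m * P n k.
Proof.
move=> /andP[lenk lekm].
have sumE i p : P i p = \sum_(0 <= j < p.+1) qbin q p j * L i j * W (p - j)%N.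
  by rewrite PE convC /conv big_mkord.
(* The term j = k stands alone, with [W 0 = 1]: it pays for all indices from [k] on in [P n m]. *)
have PnkE : P n k = \sum_(0 <= j < k) qbin q k j * L n j * W (k - j)%N + L n k.
  rewrite sumE big_nat_recr //= qbinnn subnn /W conv0 /A /B !rising0; ring.
rewrite PnkE mulrDr [P n m]sumE (big_cat_nat (leq0n k) (leqW lekm)) /=.
apply: leSD.
  rewrite mulr_sumr; apply: leS_sum_nat => j /andP[_ ltjk].
  have jkm : (j <= k <= m)%N by rewrite ltnW.
  have := leSMl (L_in n j) (leS_qbin_constant_coef jkm).
  by congr (_ - _ \in S); ring.
(* The part of [P k m] below index [k] is discarded as nonnegative. *)
rewrite sumE (big_cat_nat (leq0n k) (leqW lekm)) /= mulrDl.
rewrite -[X in _ - X]add0r; apply: leSD.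
  rewrite subr0 rpredM ?L_in // rpred_sum // => j _.
  by rewrite !rpredM ?qbin_in.
rewrite mulr_suml; apply: leS_sum_nat => j /andP[lekj _].
rewrite mulrAC; apply: leSMr => //; rewrite -mulrA.
apply: leSMl; rewrite ?qbin_in //.
by apply: leS_lah_minor => //; rewrite lenk.
Qed.

End Minor.

End CoefficientwiseOrder.

(** * Specialization to the polynomial ring *)

Lemma g_asc_rec : asc_rec q alpha beta eps1 eps2 g.
Proof.
split=> [i|n i]; first by rewrite /g coef1.
have bE : b_ n = (alpha + beta) * q ^+ n + (eps1 + eps2) * qnat q n by [].
have coefXM_phat : ('X * phat n)`_i = mulX (g n) i by rewrite coefXM; case: i.
rewrite {1}/g [phat n.+1]/= coefB mulrDl coefD coefXM_phat !coefCM bE -/(g n i).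
congr (_ - _); case: n {bE coefXM_phat} => [|n].
  by rewrite coef0 mulr0 qnat0 !mul0r.
rewrite -/(g n i) /= /lambda_ -![qint _]/(qnat q _); congr (_ * _).
(* This exposes the factor [n + 1]: q^(2n+1) - q^n = q^n (q - 1) [n + 1]. *)
have -> : (2 * n.+1).-1 = (n + n.+1)%N by rewrite mul2n -addnn addSn.
by rewrite exprD (expr_qnat q n.+1) /=; ring.
Qed.

Theorem theorem2p14 (n a b : nat) :
  coef_ge (g (n + a + b) (n + a) * g (n + a) n) (g (n + a + b) n).
Proof.
have var_in (i : 'I_5) : 'X_i \in mpolyOver 5 (@Num.nneg int).
  by rewrite mpolyOverX.
have gE := asc_rec_uniq g_asc_rec (asc_rec_rising q alpha beta eps1 eps2).
(* Coefficientwise nonnegativity is membership in [mpolyOver] of the nonnegative integers, the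
   semiring to which [leS_minor] is applied. *)
move=> m; rewrite -nnegrE; move: m; apply/mpolyOverP; rewrite !gE.
by apply: leS_minor; rewrite ?var_in // leq_addr leq_addr.
Qed.
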